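(* Let $n\ge 1$, $k\ge 1$, let $\mathcal{H}$ be a Hilbert space, and let $I$ denote the identity matrix in $M_n(\mathbb{C})$. If $\varphi: M_n(\mathbb{C})^k\to\mathcal{B}(\mathcal{H})$ is an invariant positive $k$-linear map, then $\|\varphi\|=\|\varphi(I,I,\ldots,I)\|$.
   Context: Here $\mathcal{A}=M_n(\mathbb{C})$, $\mathcal{B}=\mathcal{B}(\mathcal{H})$ in the following definitions. Let $\mathcal{A},\mathcal{B}$ be unital $C^*$-algebras, $k\ge1$, $m=\lfloor (k+1)/2\rfloor$ (so $k=2m-1$ or $k=2m$), and $\mathcal{A}^k=\mathcal{A}\times\cdots\times\mathcal{A}$ ($k$ times). A $k$-linear map $\varphi:\mathcal{A}^k\to\mathcal{B}$ is positive if $\varphi(a_1,\ldots,a_k)\ge 0$ whenever $(a_1,a_2,\ldots,a_k)=(a_k^*,a_{k-1}^*,\ldots,a_1^* )$, with the additional assumption $a_m\ge 0$ when $k$ is odd. A $k$-linear map $\varphi:\mathcal{A}^k\to\mathcal{B}$ is invariant if: when $k=2m-1$, $\varphi(a_1c_1,\ldots,a_{m-1}c_{m-1},a_m,a_{m+1},\ldots,a_{2m-1})=\varphi(a_1,\ldots,a_{m-1},a_m,c_{m-1}a_{m+1},\ldots,c_1a_{2m-1})$ for all $a_1,\ldots,a_{2m-1},c_1,\ldots,c_{m-1}\in\mathcal{A}$; when $k=2m$, $\varphi(a_1c_1,\ldots,a_mc_m,a_{m+1},\ldots,a_{2m})=\varphi(a_1,\ldots,a_m,c_ma_{m+1},\ldots,c_1a_{2m})$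 for all $a_1,\ldots,a_{2m},c_1,\ldots,c_m\in\mathcal{A}$. The norm is $\|\varphi\|=\sup\{\|\varphi(a_1,\ldots,a_k)\|:\|a_l\|\le 1 \text{ for } 1\le l\le k\}$. *)

(* Defs.v *)
From HB Require Import structures.
From mathcomp Require Import all_boot all_order all_algebra.
From mathcomp Require Export complex.
From mathcomp Require Import all_classical all_reals ereal topology normedtype.

Set Implicit Arguments.
Unset Strict Implicit.
Unset Printing Implicit Defensive.

Import Order.TTheory GRing.Theory Num.Theory.
Import numFieldNormedType.Exports.

Local Open Scope classical_set_scope.
Local Open Scope ring_scope.
Local Open Scope sesquilinear_scope.

(* The operator norm ||T|| = sup {N (T x) : N x <= 1} attached to a norm N.
   It is valued in \bar R, where the supremum always exists. *)
Definition opnorm (R : realType) (V : Type) (N : V -> R) (T : V -> V) : \bar R :=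
  ereal_sup [set (N (T x))%:E | x in [set x | N x <= 1]].

Section Matrices.
Variables (R : realType) (n : nat).

Definition l2norm (v : 'cV[R[i]]_n) : R :=
  Num.sqrt (complex.Re ((v ^t* *m v) 0 0)).

(* The C*-norm of M_n(C); the norm `|A| that normedtype puts on matrices is
   the entrywise maximum instead. *)
Definition mxopnorm (A : 'M[R[i]]_n) : \bar R := opnorm l2norm (mulmx A).

(* On R[i], 0 <= z means that z is real and nonnegative, so that both
   positivity notions of this file force self-adjointness. *)
Definition mxpos (A : 'M[R[i]]_n) : Prop :=
  forall v : 'cV[R[i]]_n, 0 <= (v ^t* *m A *m v) 0 0.

End Matrices.

Section Operators.
Variables (R : realType) (H : completeNormedModType R[i]).

(* A complete normed space is a Hilbert space for the inner product ip, linear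
   in its first argument, when ip induces the norm. *)
Definition hilbert_space (ip : {dot H for Num.conj}) : Prop :=
  forall x : H, `|x| ^+ 2 = ip x x.

(* B(H), as a set of functions. *)
Definition bounded_op : set (H -> H) :=
  [set T | linear T /\ continuous T].

(* The norm of H takes its values in R[i]. *)
Definition bopnorm (T : H -> H) : \bar R :=
  opnorm (fun x : H => complex.Re `|x|) T.

Definition oppos (ip : {dot H for Num.conj}) (T : H -> H) : Prop :=
  forall x : H, 0 <= ip (T x) x.

End Operators.

(* Tuples (a_1, ..., a_k) are functions on 'I_k, so a_l has index l - 1 and
   a_(k + 1 - l) is reached by rev_ord. *)
Section MultilinearMaps.
Variables (R : realType) (H : completeNormedModType R[i]) (n k : nat).
Implicit Types (phi : ('I_k -> 'M[R[i]]_n) -> H -> H) (a c : 'I_k -> 'M[R[i]]_n).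

(* dfwith a x is the tuple a with its entry number i replaced by x. *)
Definition multilinear phi : Prop :=
  forall (i : 'I_k) a, linear (fun x : 'M[R[i]]_n => phi (dfwith a i x)).

(* For odd k, the index k./2 is that of the middle entry a_m. *)
Definition positive_map (ip : {dot H for Num.conj}) phi : Prop :=
  forall a,
    (forall i : 'I_k, a i = (a (rev_ord i)) ^t*) ->
    (odd k -> forall i : 'I_k, nat_of_ord i = k./2 -> mxpos (a i)) ->
    oppos ip (phi a).

(* k./2 is m - 1 for k = 2m - 1 and m for k = 2m, the number of the c_j in
   both cases; the entries of c from k./2 on are not used. *)
Definition invariant_map phi : Prop :=
  forall a c,
    phi (fun i => if (i < k./2)%N then a i *m c i else a i) =
    phi (fun i => if (rev_ord i < k./2)%N then c (rev_ord i) *m a i else a i).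

Definition mapnorm phi : \bar R :=
  ereal_sup [set bopnorm (phi a) |
             a in [set a | forall l : 'I_k, (mxopnorm (a l) <= 1)%E]].

End MultilinearMaps.

(* Main.v *)
Require Import Defs.
From mathcomp Require Import all_boot all_order all_algebra.
From mathcomp Require Import zify ring lra.
From mathcomp Require Import all_classical all_reals ereal topology normedtype.

(* Invariance moves the first half of the arguments to the second half: phi a
   is the value of phi at (1, ..., 1, b_(h+1), ..., b_k) for contractions b_i,
   and phi is a positive operator when these b_i are all of the form q^* q.
   Each contraction b_i is a sum of d_l p_l with |d_l| = 1, p_l positive
   semidefinite and p_1 + p_2 + ... = 1.  Expanding, phi a is a combination of
   positive operators T_t with sum T = phi (1, ..., 1) and with coefficients
   of modulus 1, so 2 |<phi a x, y>| <= <T x, x> + <T y, y>. *)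

Set Implicit Arguments.
Unset Strict Implicit.
Unset Printing Implicit Defensive.

Import Order.TTheory GRing.Theory Num.Theory.

Local Open Scope ring_scope.
Local Open Scope sesquilinear_scope.

(** * Contractions as unimodular combinations of positive matrices *)

Section ContractionDecomposition.
Variable C : numClosedFieldType.

Lemma trmxC_mul m n p (A : 'M[C]_(m, n)) (B : 'M[C]_(n, p)) :
  (A *m B)^t* = B^t* *m A^t*.
Proof. by rewrite trmx_mul map_mxM. Qed.

Lemma trmxC1 n : (1%:M : 'M[C]_n)^t* = 1%:M.
Proof. by rewrite trmx1 map_mx1. Qed.

Lemma sqnorm_ge0 n (v : 'cV[C]_n) : 0 <= (v^t* *m v) 0 0.
Proof.
by rewrite mxE sumr_ge0// => i _; rewrite !mxE mulrC mul_conjC_ge0.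
Qed.

Lemma mul_trmxC_diag n m (D : 'rV[C]_n) (Q : 'M[C]_(n, m)) :
  Q^t* *m diag_mx D *m Q = \sum_l D 0 l *: ((row l Q)^t* *m row l Q).
Proof.
rewrite mul_mx_diag; apply/matrixP => i j; rewrite summxE !mxE.
apply: eq_bigr => l _; rewrite !mxE big_ord1 !mxE.
by rewrite mulrAC mulrC.
Qed.

(** By the spectral theorem [A = P^t* *m diag_mx D *m P] with [D] nonnegative; [Z] is the square
    root of the diagonal part times [P]. *)
Lemma psd_factor n (A : 'M[C]_n) :
    A^t* = A -> (forall v : 'cV[C]_n, 0 <= (v^t* *m A *m v) 0 0) ->
  exists Z : 'M[C]_n, A = Z^t* *m Z.
Proof.
move=> hA A_ge0.
have /orthomx_spectralP : A \is normalmx by apply/normalmxP; rewrite hA.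
set P := spectralmx A; set D := spectral_diag A => defA.
have uP : P \is unitarymx by exact: spectral_unitarymx.
rewrite invmx_unitary// in defA.
have D_ge0 l : 0 <= D 0 l.
  (* Testing [A] on its [l]-th eigenvector isolates the eigenvalue [D 0 l]. *)
  have := A_ge0 (P^t* *m delta_mx l 0); rewrite defA trmxC_mul trmxCK !mulmxA.
  rewrite (mulmxtVK _ uP) -!mulmxA (mulmxA P) (unitarymxP uP) mul1mx.
  by rewrite trmx_delta map_delta_mx mulmxA -rowE -colE !mxE eqxx mulr1n.
exists (diag_mx (map_mx sqrtC D) *m P).
rewrite trmxC_mul tr_diag_mx map_diag_mx mulmxA -[_ *m _ *m diag_mx _]mulmxA.
rewrite mulmx_diag {1}defA; congr (_ *m _ *m _); congr diag_mx.
apply/rowP => l; rewrite !mxE /=.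
by rewrite conj_Creal ?ger0_real ?sqrtC_ge0// -expr2 sqrtCK.
Qed.

(** For a rectangular matrix, [unitarymx] means orthonormal rows. The missing rows come from
    Gram-Schmidt on the orthogonal complement of the row space, whose dimension is [n]. *)
Lemma unitary_complete m n (V : 'M[C]_(m, m + n)) : V \is unitarymx ->
  exists X : 'M[C]_(n, m + n), col_mx V X \is unitarymx.
Proof.
move=> uV.
pose Vo := orthomx Num.conj (hermitian1mx (m + n)) V.
have rn : \rank Vo = n.
  by rewrite rank_ortho mxrank_unitary// addKn.
have [X [uX VX]] : exists X : 'M[C]_(\rank Vo, m + n),
    X \is unitarymx /\ V *m X^t* = 0.
  exists (schmidt (row_base Vo)); split.
    by rewrite schmidt_unitarymx ?rank_leq_col.
  apply/orthomx1P; rewrite orthomx_sym.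
  by rewrite eqmx_schmidt_free ?eq_row_base ?row_base_free.
rewrite rn in X uX VX; exists X; apply/unitarymxP.
rewrite tr_col_mx map_row_mx mul_col_row (unitarymxP uV) (unitarymxP uX) VX.
have -> : X *m V^t* = 0 by rewrite -[LHS]trmxCK trmxC_mul trmxCK VX trmx0 map_mx0.
by rewrite -scalar_mx_block.
Qed.

(** Squared norms keep the condition inside [C], free of suprema and square roots. *)
Definition contraction n (B : 'M[C]_n) : Prop :=
  forall v : 'cV[C]_n, ((B *m v)^t* *m (B *m v)) 0 0 <= (v^t* *m v) 0 0.

(* A contraction is a corner of a unitary matrix; the spectral decomposition
   of the latter, compressed to the corner, gives the resolution Z. *)
Lemma contraction_resolution n (B : 'M[C]_n) : contraction B ->
  exists (d : 'I_(n + n) -> C) (Z : 'I_(n + n) -> 'M[C]_n),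
    [/\ forall l, `|d l| = 1,
        B = \sum_l d l *: ((Z l)^t* *m Z l) &
        \sum_l (Z l)^t* *m Z l = 1%:M].
Proof.
move=> cB.
(* The defect [c] is chosen so that the block row [V] below satisfies [V *m V^t* = 1%:M]. *)
have [c defc] : exists c : 'M[C]_n, 1%:M - B^t* *m B = c^t* *m c.
  apply: psd_factor => [|v].
    by rewrite linearB/= map_mxB trmxC1 trmxC_mul trmxCK.
  rewrite mulmxBr mulmx1 mulmxBl mxE [X in _ + X]mxE subr_ge0 mulmxA -mulmxA -trmxC_mul.
  exact: cB.
pose V := row_mx (B^t*) (c^t*).
have uV : V \is unitarymx.
  apply/unitarymxP; rewrite tr_row_mx map_col_mx mul_row_col !trmxCK -defc.
  by rewrite addrC subrK.
have [X uW] := unitary_complete uV.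
move: uW; set W := col_mx V X => uW.
have W1 : W^t* *m W = 1%:M by rewrite -[W^t*]mul1mx mulmxKtV.
have /orthomx_spectralP : W \is normalmx.
  by apply/normalmxP; rewrite W1 (unitarymxP uW).
set S := spectralmx W; set D := spectral_diag W => defW.
have uS : S \is unitarymx by exact: spectral_unitarymx.
rewrite invmx_unitary// in defW.
(* Compression by [J] gives the upper left corner of [W]. This corner is the adjoint of [B], so the
   eigenvalues of [W] enter [B] conjugated. *)
pose J : 'M[C]_(n, n + n) := row_mx 1%:M 0.
have BJ : B^t* = J *m W *m J^t*.
  rewrite /J /W mul_row_col mul1mx mul0mx addr0 tr_row_mx map_col_mx trmxC1.
  by rewrite trmx0 map_mx0 mul_row_col mulmx1 mulmx0 addr0.
have JJ : J *m J^t* = 1%:M.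
  by rewrite tr_row_mx map_col_mx mul_row_col trmxC1 mul1mx mul0mx addr0.
have [Q SJ] : exists Q, S *m J^t* = Q by exists (S *m J^t*).
have JS : J *m S^t* = Q^t* by rewrite -SJ trmxC_mul trmxCK.
have QQ : Q^t* *m Q = 1%:M.
  by rewrite -JS -SJ mulmxA mulmxKtV.
have defB : B = \sum_l (D 0 l)^* *: ((row l Q)^t* *m row l Q).
  rewrite -[B]trmxCK BJ defW !mulmxA.
  rewrite JS -[_ *m S *m _]mulmxA SJ.
  rewrite !trmxC_mul trmxCK mulmxA tr_diag_mx map_diag_mx mul_trmxC_diag.
  by apply: eq_bigr => l _; rewrite !mxE.
have D1 l : `|(D 0 l)^*| = 1.
  have /(congr1 (fun M => S *m M *m S^t*)) := W1.
  rewrite defW !trmxC_mul trmxCK !mulmxA (unitarymxP uS) mul1mx.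
  rewrite !(mulmxtVK _ uS) mulmx1 (unitarymxP uS).
  rewrite tr_diag_mx map_diag_mx mulmx_diag => /matrixP/(_ l l).
  rewrite !mxE eqxx !mulr1n mulrC -normCK => /eqP.
  by rewrite sqrp_eq1 ?norm_conjC// => /eqP.
have /choice[Z defZ] : forall l, exists Z : 'M[C]_n,
    (row l Q)^t* *m row l Q = Z^t* *m Z.
  move=> l; apply: psd_factor => [|v]; first by rewrite trmxC_mul trmxCK.
  by rewrite mulmxA -trmxC_mul -mulmxA sqnorm_ge0.
exists (fun l => (D 0 l)^*), Z; split => //.
  by rewrite {1}defB; apply: eq_bigr => l _; rewrite defZ.
rewrite -QQ -[Q^t*]mulmx1 -diag_const_mx mul_trmxC_diag.
by apply: eq_bigr => l _; rewrite mxE scale1r defZ.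
Qed.

End ContractionDecomposition.

(** * Cauchy-Schwarz inequality for a positive operator *)

Section PositiveOperator.
Variables (C : numClosedFieldType) (U : lmodType C).
Variables (form : {dot U for (@Num.conj C)}) (T : U -> U).
Hypotheses (linT : linear T) (T_ge0 : forall x, 0 <= form (T x) x).

Lemma form_line c x y :
  form (T (x + c *: y)) (x + c *: y) =
  form (T x) x + `|c| ^+ 2 * form (T y) y + (c^* * form (T x) y + c * form (T y) x).
Proof.
have -> : T (x + c *: y) = T x + c *: T y by rewrite addrC linT addrC.
rewrite linearDl/= !linearDr/= !linearZl_LR !linearZr_LR/= normCK.
by rewrite !mulrA [c * c^*]mulrC; ring.
Qed.

(** By [form_line] the cross term is a combination of real numbers. *)
Lemma real_cross c x y :
  (c^* * form (T x) y + c * form (T y) x)^* =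
  c^* * form (T x) y + c * form (T y) x.
Proof.
apply/CrealP.
have -> : c^* * form (T x) y + c * form (T y) x =
  form (T (x + c *: y)) (x + c *: y) - (form (T x) x + `|c| ^+ 2 * form (T y) y).
  by rewrite form_line [X in X - _]addrC addrK.
by rewrite rpredB ?rpredD ?rpredM ?rpredX ?ger0_real.
Qed.

(** Polarization: the cross terms for [c = 1] and [c = 'i] are real, and these two equations
    determine [form (T y) x]. *)
Lemma positive_form_herm x y : form (T y) x = (form (T x) y)^*.
Proof.
have := real_cross 1 x y; have := real_cross 'i x y.
rewrite !rmorphD !rmorphM /= conjCK conjC1 conjCi !mul1r.
set p := form (T x) y; set q := form (T y) x => e1 e2.
have e3 : p^* - q^* = q - p.
  by apply: (mulfI (neq0Ci C)); rewrite mulrBr -mulNr e1; ring.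
apply: (@mulfI _ 2%:R); first by rewrite pnatr_eq0.
have -> : 2%:R * q = (p + q) + (q - p) by ring.
by rewrite -e2 -e3; ring.
Qed.

(** The arithmetic-mean form of Cauchy-Schwarz is used because its right side is additive in [T]. *)
Lemma positive_form_le x y :
  2%:R * `|form (T x) y| <= form (T x) x + form (T y) y.
Proof.
set p := form (T x) y; have [->|p0] := eqVneq p 0.
  by rewrite normr0 mulr0 addr_ge0.
(* This phase turns each of the two cross terms at [x + c *: y] into the negative of the modulus of
   [p]. *)
pose c := - (p / `|p|).
have c1 : `|c| = 1 by rewrite normrN normf_div normr_id divff ?normr_eq0.
have cp : c^* * p = - `|p|.
  rewrite rmorphN rmorphM fmorphV /= (@conj_Creal _ `|p|) ?normr_real// mulNr; congr (- _).
  by rewrite mulrAC [_ * p]mulrC -normCK expr2 mulfK ?normr_eq0.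
have := T_ge0 (x + c *: y).
rewrite form_line c1 expr1n mul1r (positive_form_herm x y) -/p.
have -> : c * p^* = (c^* * p)^* by rewrite rmorphM /= conjCK.
rewrite cp rmorphN /= (@conj_Creal _ `|p|) ?normr_real// -opprD subr_ge0.
by rewrite mulr_natl mulr2n.
Qed.

End PositiveOperator.

(** * From the operator norm on matrices to contractions *)

Section MatrixNorm.
Variables (R : realType) (n : nat).
Implicit Types (A B : 'M[R[i]]_n) (v : 'cV[R[i]]_n).

Lemma sqnormZ (c : R[i]) v :
  ((c *: v)^t* *m (c *: v)) 0 0 = `|c| ^+ 2 * (v^t* *m v) 0 0.
Proof.
rewrite !mxE mulr_sumr; apply: eq_bigr => l _; rewrite !mxE /= rmorphM /= normCK.
by ring.
Qed.

Lemma sqnorm_eq0 v : (v^t* *m v) 0 0 = 0 -> v = 0.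
Proof.
rewrite mxE => /eqP; rewrite psumr_eq0 => [/allP v0|l _]; last first.
  by rewrite !mxE mulrC mul_conjC_ge0.
apply/colP => l; have := v0 l (mem_index_enum _).
by rewrite !mxE /= mulrC mul_conjC_eq0 => /eqP.
Qed.

Lemma l2norm_le1 v : (l2norm v <= 1) = ((v^t* *m v) 0 0 <= 1).
Proof.
have := sqnorm_ge0 v; rewrite /l2norm; set q := (_ *m _) 0 0.
rewrite !lecE /= => /andP[/eqP -> q0]; rewrite eqxx /=.
by rewrite -{1}sqrtr1 ler_sqrt.
Qed.

(** Rescaling a nonzero [v] to norm 1 places it in the ball over which the supremum is taken. *)
Lemma mxopnorm_contraction A : (mxopnorm A <= 1)%E -> contraction A.
Proof.
move=> A1 v; set q := (v^t* *m v) 0 0.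
have [q0|q_neq0] := eqVneq q 0.
  by rewrite (sqnorm_eq0 q0) mulmx0 q0 trmx0 map_mx0 mul0mx mxE.
have q_gt0 : 0 < q by rewrite lt_def q_neq0 sqnorm_ge0.
pose c := (sqrtC q)^-1.
have c2 : `|c| ^+ 2 = q^-1.
  by rewrite normfV ger0_norm ?sqrtC_ge0 1?ltW// exprVn sqrtCK.
have v1 : l2norm (c *: v) <= 1 by rewrite l2norm_le1 sqnormZ c2 mulVf.
have : ((l2norm (A *m (c *: v)))%:E <= 1)%E.
  by apply: le_trans A1; apply: ereal_sup_ubound; exists (c *: v).
rewrite lee_fin l2norm_le1 -scalemxAr sqnormZ c2.
by rewrite mulrC ler_pdivrMr// mul1r.
Qed.

Lemma mxopnorm1 : (mxopnorm (1%:M : 'M[R[i]]_n) <= 1)%E.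
Proof.
apply: ge_ereal_sup => _ [v v1 <-]; rewrite mul1mx lee_fin; exact: v1.
Qed.

Lemma contraction_mul A B :
  contraction A -> contraction B -> contraction (A *m B).
Proof.
by move=> cA cB v; rewrite -mulmxA (le_trans (cA _)).
Qed.

Lemma mxpos_sqr A : mxpos (A^t* *m A).
Proof. by move=> v; rewrite mulmxA -trmxC_mul -mulmxA sqnorm_ge0. Qed.

End MatrixNorm.

Lemma linear_sum_scale (K : pzRingType) (U V : lmodType K) (f : U -> V) (I : finType)
    (d : I -> K) (p : I -> U) : linear f ->
  f (\sum_l d l *: p l) = \sum_l d l *: f (p l).
Proof.
move=> linf.
have f0 : f 0 = 0.
  by have := linf (-1) 0 0; rewrite scaler0 addr0 scaleN1r addNr.
rewrite (big_morph f (id1 := 0) (op1 := +%R)) => [|u v|//].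
  by apply: eq_bigr => l _; have := linf (d l) (p l) 0; rewrite f0 !addr0.
by have := linf 1 u v; rewrite !scale1r.
Qed.

(** * Domination of an invariant positive map by its value at the identity *)

Section InvariantPositiveMaps.
Variables (R : realType) (H : completeNormedModType R[i]).
Variables (ip : {dot H for (@Num.conj R[i])}) (n k : nat).
Variable phi : ('I_k -> 'M[R[i]]_n) -> H -> H.
Hypotheses (phi_bounded : forall a, bounded_op (phi a)).
Hypotheses (phi_lin : multilinear phi) (phi_inv : invariant_map phi).
Hypothesis phi_pos : positive_map ip phi.

Let half_rev (i : 'I_k) : (i < k./2)%N -> (rev_ord i < k./2)%N = false.
Proof. by move=> /=; have := ltn_ord i; lia. Qed.

Let half_mid (i : 'I_k) : (i < k./2)%N = false -> (rev_ord i < k./2)%N = false ->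
  rev_ord i = i.
Proof. by move=> /= h1 h2; apply: val_inj => /=; have := ltn_ord i; lia. Qed.

(** Each entry of the first half is read as [1%:M *m a i], and invariance carries the factor [a i]
    to the mirror position. *)
Lemma invariant_normal_form a :
  phi a = phi (fun i => if (i < k./2)%N then 1%:M
    else if (rev_ord i < k./2)%N then a (rev_ord i) *m a i else a i).
Proof.
have := phi_inv (fun i => if (i < k./2)%N then 1%:M else a i) a.
have -> : (fun i : 'I_k => if (i < k./2)%N
    then (if (i < k./2)%N then 1%:M else a i) *m a i
    else if (i < k./2)%N then 1%:M else a i) = a.
  by apply/funext => i; case: (i < _)%N; rewrite ?mul1mx.
move=> ->; congr phi; apply/funext => i.
case: (boolP (i < k./2)%N) => [/half_rev -> //|_].
by case: ifP.
Qed.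

Lemma positive_on_squares (q : 'I_k -> 'M[R[i]]_n) :
  oppos ip (phi (fun i : 'I_k => if (i < k./2)%N then 1%:M else (q i)^t* *m q i)).
Proof.
(* This tuple is symmetric under reversal with adjoints, and its normal form is the tuple of
   squares. When [k] is odd, the middle entry has no partner and must itself be a square. *)
pose a (i : 'I_k) := if (i < k./2)%N then (q (rev_ord i))^t*
  else if (rev_ord i < k./2)%N then q i else (q i)^t* *m q i.
have -> : (fun i : 'I_k => if (i < k./2)%N then 1%:M else (q i)^t* *m q i) =
    (fun i : 'I_k => if (i < k./2)%N then 1%:M
    else if (rev_ord i < k./2)%N then a (rev_ord i) *m a i else a i).
  apply/funext => i; case: ifP => // i_ge; rewrite /a rev_ordK i_ge.
  by case: (rev_ord i < _)%N.
rewrite -invariant_normal_form; apply: phi_pos => [i|k_odd i defi].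
  rewrite /a rev_ordK; case: (boolP (i < k./2)%N) => [/half_rev -> //|].
  move=> /negbTE i_ge; case: ifP => [_|r_ge]; first by rewrite trmxCK.
  by rewrite half_mid// trmxC_mul trmxCK.
rewrite /a defi ltnn; case: ifP => [/= |_]; last exact: mxpos_sqr.
by rewrite defi; lia.
Qed.

Section Interpolation.
Variables (b : 'I_k -> 'M[R[i]]_n) (L : finType).
Variables (d : 'I_k -> L -> R[i]) (Z : 'I_k -> L -> 'M[R[i]]_n).
Hypotheses (d1 : forall i l, `|d i l| = 1).
Hypothesis defb : forall i, b i = \sum_l d i l *: ((Z i l)^t* *m Z i l).
Hypothesis sumZ : forall i, \sum_l (Z i l)^t* *m Z i l = 1%:M.

(** In the second half, entries before [j] are those of [c] and the others are single pieces
    selected by [t]. Stage 0 consists of squares only; at stage [k] no piece remains. *)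
Definition interpolant (c : 'I_k -> 'M[R[i]]_n) (j : nat) (t : 'I_k -> L) (i : 'I_k) :=
  if (i < k./2)%N then 1%:M
  else if (i < j)%N then c i else (Z i (t i))^t* *m Z i (t i).

Lemma interpolantS c j t (i : 'I_k) : (k./2 <= i)%N -> nat_of_ord i = j ->
  interpolant c j.+1 t = dfwith (interpolant c j t) i (c i).
Proof.
move=> hi ij; apply/funext => m; case: dfwithP => [|i' ii'].
  by rewrite /interpolant ltnNge hi /= ij ltnSn.
rewrite /interpolant ltnS [(i' <= j)%N]leq_eqVlt -ij.
by rewrite (_ : (i' == i :> nat) = false)//; apply/negbTE; rewrite eq_sym.
Qed.

Lemma interpolant_dfwith c j t (i : 'I_k) l : (k./2 <= i)%N -> nat_of_ord i = j ->
  interpolant c j (dfwith t i l) =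
  dfwith (interpolant c j t) i ((Z i l)^t* *m Z i l).
Proof.
move=> hi ij; apply/funext => m; case: dfwithP => [|i' ii'].
  by rewrite /interpolant ltnNge hi /= ij ltnn dfwithin.
by rewrite /interpolant dfwithout.
Qed.

(** The weights [e] are left general to cover both [c = b], with weights [d i], and the identity
    tuple, with weights 1. *)
Lemma phi_interpolantS c j t (i : 'I_k) (e : L -> R[i]) x :
    (k./2 <= i)%N -> nat_of_ord i = j ->
    c i = \sum_l e l *: ((Z i l)^t* *m Z i l) ->
  phi (interpolant c j.+1 t) x =
  \sum_l e l *: phi (interpolant c j (dfwith t i l)) x.
Proof.
move=> hi ij ci; rewrite (interpolantS _ _ hi ij) ci.
rewrite (linear_sum_scale _ _ (phi_lin i (interpolant c j t))) fct_sumE.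
by apply: eq_bigr => l _; rewrite interpolant_dfwith.
Qed.

(* Replacing one coordinate at a time, the left side is bounded by the
   triangle inequality, while the right side is additive in the pieces. *)
Lemma interpolant_le j t x y :
  2%:R * `|ip (phi (interpolant b j t) x) y| <=
  ip (phi (interpolant (fun=> 1%:M) j t) x) x +
  ip (phi (interpolant (fun=> 1%:M) j t) y) y.
Proof.
elim: j t => [|j IHj] t.
  have eqi c : interpolant c 0 t = interpolant b 0 t.
    by apply/funext => i; rewrite /interpolant ltn0.
  (* At stage 0 both sides involve the same operator, positive by [positive_on_squares]. *)
  rewrite eqi; apply: positive_form_le; first exact: (phi_bounded _).1.
  change (oppos ip (phi (interpolant b 0 t))).
  have := positive_on_squares (fun i => Z i (t i)).
  by congr (oppos ip (phi _)); apply/funext => i; rewrite /interpolant ltn0.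
have [jk|kj] := ltnP j k; last first.
  have eqi c : interpolant c j.+1 t = interpolant c j t.
    apply/funext => i; rewrite /interpolant.
    have ij : (i < j)%N by exact: leq_trans (ltn_ord i) kj.
    by rewrite ij (ltnW ij : i < j.+1)%N.
  by rewrite !eqi.
(* In the first half entry [j] stays the identity, so the stage does not change. *)
have [jh|hj] := ltnP j k./2.
  have eqi c : interpolant c j.+1 t = interpolant c j t.
    apply/funext => i; rewrite /interpolant; case: ltnP => // hi.
    have ji : (j < i)%N by exact: leq_trans jh hi.
    by rewrite [(i < j.+1)%N]leqNgt [(i < j)%N]leqNgt !ltnS ji (ltnW ji).
  by rewrite !eqi.
pose i := Ordinal jk.
have one z : phi (interpolant (fun=> 1%:M) j.+1 t) z =
    \sum_l phi (interpolant (fun=> 1%:M) j (dfwith t i l)) z.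
  rewrite (@phi_interpolantS _ _ _ i (fun=> 1))//.
    by apply: eq_bigr => l _; rewrite scale1r.
  by rewrite -(sumZ i); apply: eq_bigr => l _; rewrite scale1r.
rewrite !one (@phi_interpolantS b _ _ i (d i))// !linear_sumlz -big_split /=.
rewrite (le_trans (ler_wpM2l _ (ler_norm_sum _ _ _)))// mulr_sumr.
apply: ler_sum => l _.
by rewrite linearZl_LR /= normrM d1 mul1r.
Qed.

End Interpolation.

Lemma contractions_form_le (a : 'I_k -> 'M[R[i]]_n) x y : (0 < n)%N ->
    (forall i, contraction (a i)) ->
  2%:R * `|ip (phi a x) y| <=
  ip (phi (fun=> 1%:M) x) x + ip (phi (fun=> 1%:M) y) y.
Proof.
move=> n_gt0 ca; rewrite invariant_normal_form; set b := fun i => _.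
have cb i : contraction (b i).
  rewrite /b; case: ifP => _; first by move=> v; rewrite mul1mx.
  by case: ifP => _ //; apply: contraction_mul.
have /choice[d /choice[Z dZ]] := fun i => contraction_resolution (cb i).
have d1 i l : `|d i l| = 1 by have [] := dZ i.
have defb i : b i = \sum_l d i l *: ((Z i l)^t* *m Z i l) by have [] := dZ i.
have sumZ i : \sum_l (Z i l)^t* *m Z i l = 1%:M by have [] := dZ i.
(* Some selection [t] must be supplied to reach stage [k]; [0 < n] makes the index set inhabited. *)
have l0 : 'I_(n + n) by exists 0; rewrite addn_gt0 n_gt0.
have := interpolant_le d1 defb sumZ k (fun=> l0) x y.
have -> : interpolant Z b k (fun=> l0) = b.
  by apply/funext => i; rewrite /interpolant ltn_ord /b; case: (i < _)%N.
have -> // : interpolant Z (fun=> 1%:M) k (fun=> l0) = fun=> 1%:M.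
by apply/funext => i; rewrite /interpolant ltn_ord if_same.
Qed.

End InvariantPositiveMaps.

(** * Norms as inner products with vectors of the unit ball *)

Section HilbertSpace.
Variables (R : realType) (H : completeNormedModType R[i]).
Variable ip : {dot H for (@Num.conj R[i])}.
Hypothesis hilb : hilbert_space ip.

Lemma ip_normalized (z : H) : ip z (`|z|^-1 *: z) = `|z|.
Proof.
have -> : ip z (`|z|^-1 *: z) = (`|z|^-1)^* * ip z z by exact: linearZr_LR.
rewrite -hilb conj_Creal ?realV ?normr_real//.
(* For [z = 0] the convention that the inverse of 0 is 0 makes both sides vanish. *)
have [->|z0] := eqVneq `|z| 0; first by rewrite expr0n mulr0.
by rewrite expr2 mulKf.
Qed.

Lemma normalized_le1 (z : H) : `|(`|z|^-1 *: z)| <= 1.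
Proof.
rewrite normrZ normfV normr_id.
by have [->|z0] := eqVneq `|z| 0; rewrite ?mulr0// mulVf.
Qed.

(** This is [positive_form_le] for the identity operator, applied to the normalization of [u]. *)
Lemma norm_ip_le (u v : H) : `|v| <= 1 -> `|ip u v| <= `|u|.
Proof.
move=> v1; have [->|u0] := eqVneq u 0; first by rewrite linear0l !normr0.
have u_gt0 : 0 < `|u| by rewrite normr_gt0.
have := @positive_form_le _ _ ip id (fun=> fun=> fun=> erefl) (dnorm_ge0 ip)
  (`|u|^-1 *: u) v.
rewrite linearZl_LR /= normrM normfV normr_id -!hilb => le2.
rewrite -[leRHS]mulr1 -ler_pdivrMl// -(ler_pM2l (x := 2%:R)) ?ltr0n//.
rewrite (le_trans le2)// mulr1 [leRHS]mulr2n lerD//.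
  by rewrite exprn_ile1// normalized_le1.
by rewrite exprn_ile1.
Qed.

Lemma Re_norm_le1 (x : H) : (complex.Re `|x| <= 1) = (`|x| <= 1).
Proof.
have := normr_ge0 x; set r := `|x|.
by rewrite !lecE /= => /andP[/eqP -> _]; rewrite eqxx.
Qed.

End HilbertSpace.

Theorem theorem2p3 (R : realType) (n k : nat) (hn : (0 < n)%N) (hk : (0 < k)%N)
    (H : completeNormedModType R[i]) (ip : {dot H for Num.conj})
    (hH : hilbert_space ip)
    (phi : ('I_k -> 'M[R[i]]_n) -> H -> H)
    (hB : forall a, bounded_op (phi a))
    (hlin : multilinear phi)
    (hinv : invariant_map phi)
    (hpos : positive_map ip phi) :
  mapnorm phi = bopnorm (phi (fun _ : 'I_k => 1%:M)).
Proof.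
(* The lower bound holds because the identity tuple lies in the unit ball. *)
apply/eqP; rewrite eq_le; apply/andP; split; last first.
  by apply: ereal_sup_ubound; exists (fun=> 1%:M) => // l; exact: mxopnorm1.
apply: ge_ereal_sup => _ [a a1 <-]; apply: ge_ereal_sup => _ [x x1 <-].
set T := phi (fun=> 1%:M); set z := phi a x.
have T_ge0 : oppos ip T.
  apply: hpos => [i|_ i _]; first by rewrite trmxC1.
  by rewrite -[1%:M]mul1mx -{1}trmxC1; exact: mxpos_sqr.
have le_bop y : `|y| <= 1 -> ((complex.Re `|T y|)%:E <= bopnorm T)%E.
  by rewrite -Re_norm_le1 => y1; apply: ereal_sup_ubound; exists y.
have ip_le y : `|y| <= 1 -> ip (T y) y <= `|T y|.
  by move=> y1; rewrite -[leLHS]ger0_norm// norm_ip_le.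
(* Pairing [z] with [y] gives the norm of [z]. *)
pose y := `|z|^-1 *: z.
have y1 : `|y| <= 1 := normalized_le1 z.
move: x1; rewrite /= Re_norm_le1 => x1.
have : 2%:R * `|z| <= `|T x| + `|T y|.
  rewrite -{1}[`|z|]normr_id -(ip_normalized hH).
  apply: le_trans (lerD (ip_le _ x1) (ip_le _ y1)).
  apply: contractions_form_le => // l.
  exact/mxopnorm_contraction/a1.
rewrite mulr_natl mulr2n lecE => /andP[_].
rewrite !raddfD /= => le2.
(* The norm of [z] is at most the mean of those of [T x] and [T y], hence at most the larger one. *)
have [xy|yx] := leP (complex.Re `|T x|) (complex.Re `|T y|).
  apply: le_trans (le_bop _ y1); rewrite lee_fin; lra.
apply: le_trans (le_bop _ x1); rewrite lee_fin; lra.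
Qed.
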